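(* Let $0<b<1$ and let $p,q\in\mathbb{N}^*$ be positive integers with $p\le q$. Set $\mathcal{B}:=\frac{1-b^2}{1+b^2}$, $\mathcal{A}:=\frac pq$, $$\lambda:=\frac{1+\mathcal{B}(\mathcal{A}+1)}{1+\mathcal{B}(\mathcal{A}^{-1}+1)},\qquad \Delta:=[1-\lambda+(\mathcal A-\lambda)\mathcal B(1+\lambda)]^2+4[\lambda+(\mathcal A+1)\mathcal B\lambda(1+\lambda)],$$ $$s_0:=\sqrt{\frac{-[1-\lambda+(\mathcal A-\lambda)\mathcal B(1+\lambda)]+\sqrt\Delta}{2[\lambda+(\mathcal A+1)\mathcal B\lambda(1+\lambda)]}}.$$ Then the set of global minimizers of $(z_1,z_2)\mapsto W^{\rm micro}[(z_1,z_2),(p,q)]$ on $(\mathbb{D}^2)^*$ is $$\left\{\left(s_0e^{\imath\theta},-\lambda s_0e^{\imath\theta}\right)\in(\mathbb{D}^2)^* : \theta\in\mathbb{R}\right\}.$$ In particular, if $p=q$, the set of minimizers of $W^{\rm micro}[\cdot,(p,p)]$ is $$\left\{\left(\Big(1+4\tfrac{1-b^2}{1+b^2}\Big)^{-1/4}e^{\imath\theta},-\Big(1+4\tfrac{1-b^2}{1+b^2}\Big)^{-1/4}e^{\imath\theta}\right) : \theta\in\mathbb{R}\right\}.$$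
   Context: $\mathbb{D}$ is the open unit disc in $\mathbb{C}$ and $(\mathbb{D}^2)^*=\{(z_1,z_2)\in\mathbb{D}^2 : z_1\ne z_2\}$. $W^{\rm micro}$ is the microscopic renormalized energy of the circular impurity $\mathbb{D}$ (weight $b^2$ in $\mathbb{D}$ and $1$ outside), which for two vortices $(z_1,z_2)\in(\mathbb{D}^2)^*$ with degrees $(p,q)$ is given explicitly by $$W^{\rm micro}[(z_1,z_2),(p,q)]=-b^2\pi\left\{2pq\ln|z_1-z_2|+\frac{1-b^2}{1+b^2}\left[p^2\ln(1-|z_1|^2)+q^2\ln(1-|z_2|^2)+2pq\ln|1-z_1\overline{z_2}|\right]\right\}.$$ *)

(* Defs.v *)
From Stdlib Require Import Reals.
From Coquelicot Require Import Coquelicot.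
Open Scope R_scope.

(* Two vortices at distinct points of the open unit disc. *)
Definition disc2_star (z : C * C) : Prop :=
  Cmod (fst z) < 1 /\ Cmod (snd z) < 1 /\ fst z <> snd z.

Definition calB (b : R) : R := (1 - b ^ 2) / (1 + b ^ 2).

(* On [disc2_star] every argument of [ln] below is positive, so the value that
   [ln] takes on nonpositive reals plays no role. *)
Definition Wmicro (b : R) (p q : nat) (z : C * C) : R :=
  let z1 := fst z in
  let z2 := snd z in
  - b ^ 2 * PI *
    (2 * INR p * INR q * ln (Cmod (z1 - z2)%C)
     + calB b *
       (INR p ^ 2 * ln (1 - Cmod z1 ^ 2)
        + INR q ^ 2 * ln (1 - Cmod z2 ^ 2)
        + 2 * INR p * INR q * ln (Cmod (RtoC 1 - z1 * Cconj z2)%C))).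

Definition is_global_minimizer {T : Type} (D : T -> Prop) (f : T -> R) (z : T) : Prop :=
  D z /\ forall w : T, D w -> f z <= f w.

Definition calA (p q : nat) : R := INR p / INR q.

Definition lambda (b : R) (p q : nat) : R :=
  (1 + calB b * (calA p q + 1)) / (1 + calB b * (/ calA p q + 1)).

(* s0^2 is the positive root of quad_lead * X^2 + quad_lin * X - 1, whose
   discriminant is Delta. *)
Definition quad_lin (b : R) (p q : nat) : R :=
  1 - lambda b p q + (calA p q - lambda b p q) * calB b * (1 + lambda b p q).

Definition quad_lead (b : R) (p q : nat) : R :=
  lambda b p q + (calA p q + 1) * calB b * lambda b p q * (1 + lambda b p q).

Definition Delta (b : R) (p q : nat) : R :=
  quad_lin b p q ^ 2 + 4 * quad_lead b p q.

Definition s0 (b : R) (p q : nat) : R :=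
  sqrt ((- quad_lin b p q + sqrt (Delta b p q)) / (2 * quad_lead b p q)).

(* e^(i theta) *)
Definition Cexpi (theta : R) : C := (cos theta, sin theta).

(* Main.v *)
(* Passing from [z1], [z2] to antipodal points of the same moduli [r], [s]
   decreases the energy, so only [r] and [s] matter. With [r = tanh x],
   [s = tanh y] and [u = x + y] the quantity to maximize becomes
   [ln (sinh u) + B ln (cosh u) - alpha ln (cosh x) - beta ln (cosh y)], where
   [alpha = 1 + B (1 + A)] and [beta = 1 + B (1 + / A)]. As [B < 1] it is
   strictly concave, so its critical point is its unique maximizer. The
   critical point equations are
   [alpha tanh x = beta tanh y = / tanh u + B tanh u]: the first equality is
   [s = lambda r], the second one is the quadratic equation for [r ^ 2].
   The tangent line inequalities of the concave terms are proved in the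
   variables [r], [s] and [tanh u = (r + s) / (1 + r s)]. *)
Require Import Defs.
From Stdlib Require Import Reals Lra.
From Coquelicot Require Import Coquelicot.
Open Scope R_scope.

(** * Tangent line inequalities in the variable [t = tanh x] *)

(** The mean value theorem between [x] and [x0]; the product [f' t * (t - x0)] treats both sides of
    [x0] at once. *)
Lemma strict_max_of_derive_sign (f f' : R -> R) (a b x0 x : R) :
  a < x0 < b -> a < x < b ->
  (forall t, a < t < b -> derivable_pt_lim f t (f' t)) ->
  (forall t, a < t < b -> t <> x0 -> f' t * (t - x0) < 0) ->
  x <> x0 -> f x < f x0.
Proof.
intros Hx0 Hx Hd Hs Hne.
destruct (Rtotal_order x x0) as [Hlt | [Heq | Hgt]]; [ | easy | ].
- destruct (MVT_cor2 f f' x x0 Hlt) as [c [Hc Hcx]].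
  { intros t Ht; apply Hd; lra. }
  assert (H := Hs c ltac:(lra) ltac:(lra)).
  nra.
- destruct (MVT_cor2 f f' x0 x Hgt) as [c [Hc Hcx]].
  { intros t Ht; apply Hd; lra. }
  assert (H := Hs c ltac:(lra) ltac:(lra)).
  nra.
Qed.

Definition artanh (t : R) : R := (ln (1 + t) - ln (1 - t)) / 2.

Definition tanh_add (r s : R) : R := (r + s) / (1 + r * s).

Lemma tanh_add_bounds (r s : R) :
  0 <= r < 1 -> 0 <= s < 1 -> 0 < r + s -> 0 < tanh_add r s < 1.
Proof.
intros Hr Hs Hrs; unfold tanh_add; split.
- apply Rdiv_lt_0_compat; nra.
- apply Rlt_div_l; nra.
Qed.

Lemma artanh_tanh_add (r s : R) :
  0 <= r < 1 -> 0 <= s < 1 ->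
  artanh (tanh_add r s) = artanh r + artanh s.
Proof.
intros Hr Hs.
assert (Hp : 0 < 1 + r * s) by nra.
unfold artanh, tanh_add.
replace (1 + (r + s) / (1 + r * s)) with ((1 + r) * (1 + s) / (1 + r * s))
  by (field; lra).
replace (1 - (r + s) / (1 + r * s)) with ((1 - r) * (1 - s) / (1 + r * s))
  by (field; lra).
rewrite !ln_div, !ln_mult; try nra.
Qed.

(** For [t = tanh x], [ln (1 - t ^ 2) / 2] is [- ln (cosh x)], strictly concave in [x] with slope
    [- t0] at [t0]; the graph lies below that tangent. *)
Lemma ln_cosh_tangent (t0 t : R) :
  -1 < t0 < 1 -> -1 < t < 1 -> t <> t0 ->
  ln (1 - t ^ 2) / 2 + t0 * artanh t < ln (1 - t0 ^ 2) / 2 + t0 * artanh t0.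
Proof.
intros Ht0 Ht Hne; unfold artanh.
apply (strict_max_of_derive_sign
  (fun t => ln (1 - t ^ 2) / 2 + t0 * ((ln (1 + t) - ln (1 - t)) / 2))
  (fun t => (t0 - t) / (1 - t ^ 2)) (-1) 1); try easy.
- intros u Hu; apply is_derive_Reals; auto_derive.
  + repeat split; nra.
  + field; repeat split; nra.
- intros u Hu Hu0.
  replace ((t0 - u) / (1 - u ^ 2) * (u - t0))
    with (- ((u - t0) ^ 2 / (1 - u ^ 2))) by (field; nra).
  apply Ropp_lt_gt_0_contravar, Rdiv_lt_0_compat; [ | nra].
  apply pow2_gt_0; lra.
Qed.

(* [ln (sinh u) + B ln (cosh u)] as a function of [t = tanh u]. *)
Definition pair_term (B t : R) : R := ln t - (1 + B) / 2 * ln (1 - t ^ 2).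

(** In the variable [u = artanh t], [pair_term] has slope [/ t + B * t]. Subtracting the tangent at
    [t0] leaves a derivative whose sign is that of [t0 - t], because [1 - B * t * t0 > 0]. *)
Lemma pair_term_tangent (B t0 t : R) :
  0 < B < 1 -> 0 < t0 < 1 -> 0 < t < 1 -> t <> t0 ->
  pair_term B t - (/ t0 + B * t0) * artanh t
  < pair_term B t0 - (/ t0 + B * t0) * artanh t0.
Proof.
intros HB Ht0 Ht Hne; unfold artanh, pair_term.
apply (strict_max_of_derive_sign
  (fun t => ln t - (1 + B) / 2 * ln (1 - t ^ 2)
            - (/ t0 + B * t0) * ((ln (1 + t) - ln (1 - t)) / 2))
  (fun t => (t - t0) * (B * t * t0 - 1) / (t0 * t * (1 - t ^ 2))) 0 1); try easy.
- intros u Hu; apply is_derive_Reals; auto_derive.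
  + repeat split; nra.
  + field; repeat split; nra.
- intros u Hu Hu0.
  assert (H1 : 0 < t0 * u * (1 - u ^ 2)).
  { apply Rmult_lt_0_compat; nra. }
  replace ((u - t0) * (B * u * t0 - 1) / (t0 * u * (1 - u ^ 2)) * (u - t0))
    with (- ((u - t0) ^ 2 * (1 - B * u * t0) / (t0 * u * (1 - u ^ 2))))
    by (field; repeat split; nra).
  apply Ropp_lt_gt_0_contravar, Rdiv_lt_0_compat; [ | easy].
  apply Rmult_lt_0_compat; [apply pow2_gt_0; lra | ].
  assert (B * u < 1) by nra.
  assert (0 < B * u) by nra.
  nra.
Qed.

(** * The energy as a function of the two moduli *)

(** The energy of antipodal points of moduli [r] and [s], divided by [- 2 b^2 PI p q], with
    [A = p / q]. *)
Definition radial (A B r s : R) : R :=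
  ln (r + s)
  + B / 2 * (A * ln (1 - r ^ 2) + / A * ln (1 - s ^ 2) + 2 * ln (1 + r * s)).

(** Follows from [1 - tanh_add r s ^ 2 = (1 - r ^ 2) (1 - s ^ 2) / (1 + r s) ^ 2] on taking
    logarithms. *)
Lemma radial_split (A B r s : R) :
  0 <= r < 1 -> 0 <= s < 1 -> 0 < r + s ->
  radial A B r s =
  pair_term B (tanh_add r s)
  + (1 + B * (A + 1)) * (ln (1 - r ^ 2) / 2)
  + (1 + B * (/ A + 1)) * (ln (1 - s ^ 2) / 2).
Proof.
intros Hr Hs Hrs.
assert (Hp : 0 < 1 + r * s) by nra.
assert (Hr2 : 0 < 1 - r ^ 2) by nra.
assert (Hs2 : 0 < 1 - s ^ 2) by nra.
unfold radial, pair_term, tanh_add.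
replace (1 - ((r + s) / (1 + r * s)) ^ 2)
  with ((1 - r ^ 2) * (1 - s ^ 2) / ((1 + r * s) * (1 + r * s)))
  by (field; lra).
rewrite !ln_div, !ln_mult; try nra;
  apply Rmult_lt_0_compat; lra.
Qed.

(** The critical point equations give the three tangents a common slope [c], up to sign. As
    [artanh T = artanh r + artanh s], the linear terms cancel when the three inequalities are
    added. *)
Lemma radial_strict_max (A B r0 s1 r s : R) :
  0 < A -> 0 < B < 1 -> 0 < r0 < 1 -> 0 < s1 < 1 ->
  (1 + B * (A + 1)) * r0 = / tanh_add r0 s1 + B * tanh_add r0 s1 ->
  (1 + B * (/ A + 1)) * s1 = / tanh_add r0 s1 + B * tanh_add r0 s1 ->
  0 <= r < 1 -> 0 <= s < 1 -> 0 < r + s ->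
  (r, s) <> (r0, s1) -> radial A B r s < radial A B r0 s1.
Proof.
intros HA HB Hr0 Hs1 Hcr Hcs Hr Hs Hrs Hne.
rewrite !radial_split by lra.
assert (HT := tanh_add_bounds r s Hr Hs Hrs).
assert (HT0 := tanh_add_bounds r0 s1 ltac:(lra) ltac:(lra) ltac:(lra)).
assert (Ha := artanh_tanh_add r s Hr Hs).
assert (Ha0 := artanh_tanh_add r0 s1 ltac:(lra) ltac:(lra)).
set (T := tanh_add r s) in *; set (T0 := tanh_add r0 s1) in *.
assert (HA' : 0 < / A) by (apply Rinv_0_lt_compat; lra).
assert (Hal : 0 < 1 + B * (A + 1)) by nra.
assert (Hbe : 0 < 1 + B * (/ A + 1)) by nra.
set (al := 1 + B * (A + 1)) in *; set (be := 1 + B * (/ A + 1)) in *.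
(* Not strict: [T = T0] may occur at another pair [(r, s)]. Strictness comes from the terms in [r]
   and [s]. *)
assert (HP : pair_term B T - (/ T0 + B * T0) * artanh T
             <= pair_term B T0 - (/ T0 + B * T0) * artanh T0).
{ destruct (Req_dec T T0) as [-> | H]; [lra | ].
  apply Rlt_le, pair_term_tangent; lra. }
rewrite Ha, Ha0 in HP.
set (c := / T0 + B * T0) in *.
assert (Hscale : forall k u x, 0 < k -> k * u = c -> -1 < u < 1 -> -1 < x < 1 ->
  x <> u ->
  k * (ln (1 - x ^ 2) / 2) + c * artanh x
  < k * (ln (1 - u ^ 2) / 2) + c * artanh u).
{ intros k u x Hk <- Hu Hx Hxu.
  assert (H := ln_cosh_tangent u x Hu Hx Hxu); nra. }
assert (Hmul_r := fun H => Hscale al r0 r Hal Hcr ltac:(lra) ltac:(lra) H).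
assert (Hmul_s := fun H => Hscale be s1 s Hbe Hcs ltac:(lra) ltac:(lra) H).
destruct (Req_dec r r0) as [Er | Er]; destruct (Req_dec s s1) as [Es | Es].
- congruence.
- specialize (Hmul_s Es); rewrite Er in *; lra.
- specialize (Hmul_r Er); rewrite Es in *; lra.
- specialize (Hmul_s Es); specialize (Hmul_r Er); lra.
Qed.

(** * Polar form and antipodal points *)

Lemma unit_circle_angle (x y : R) :
  x ^ 2 + y ^ 2 = 1 -> exists theta, x = cos theta /\ y = sin theta.
Proof.
intros H.
assert (Hx : -1 <= x <= 1) by nra.
assert (Hy : sqrt (1 - x²) = Rabs y).
{ replace (1 - x²) with (y²) by (unfold Rsqr; lra). apply sqrt_Rsqr_abs. }
destruct (Rle_dec 0 y) as [H0 | H0].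
- exists (acos x).
  rewrite cos_acos, sin_acos, Hy, Rabs_pos_eq by easy; easy.
- exists (- acos x).
  rewrite cos_neg, sin_neg, cos_acos, sin_acos, Hy, Rabs_left by lra; lra.
Qed.

Lemma Cmod_sqr (z : C) : Cmod z ^ 2 = fst z ^ 2 + snd z ^ 2.
Proof. unfold Cmod; rewrite pow2_sqrt; nra. Qed.

Lemma Cmod_Cexpi (theta : R) : Cmod (Cexpi theta) = 1.
Proof.
unfold Cmod, Cexpi; simpl fst; simpl snd.
replace (cos theta ^ 2 + sin theta ^ 2) with 1; [apply sqrt_1 | ].
rewrite <- (sin2_cos2 theta); unfold Rsqr; ring.
Qed.

Lemma Cmod_eq_polar (z : C) :
  exists theta, z = (RtoC (Cmod z) * Cexpi theta)%C.
Proof.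
destruct (Req_dec (Cmod z) 0) as [Hz | Hz].
- exists 0; rewrite Hz, Cmult_0_l; now apply Cmod_eq_0.
- assert (H := Cmod_sqr z).
  destruct (unit_circle_angle (fst z / Cmod z) (snd z / Cmod z)) as [theta [Hc Hs]].
  { replace ((fst z / Cmod z) ^ 2 + (snd z / Cmod z) ^ 2)
      with ((fst z ^ 2 + snd z ^ 2) / Cmod z ^ 2) by (field; easy).
    rewrite <- H; field; easy. }
  exists theta; unfold Cexpi; rewrite <- Hc, <- Hs.
  rewrite (surjective_pairing z) at 1.
  unfold Cmult, RtoC; simpl; f_equal; field; easy.
Qed.

Lemma antipodal_of_Cmod_minus (z1 z2 : C) :
  Cmod (z1 - z2)%C = Cmod z1 + Cmod z2 ->
  exists theta, z1 = (RtoC (Cmod z1) * Cexpi theta)%C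
             /\ z2 = (RtoC (- Cmod z2) * Cexpi theta)%C.
Proof.
(* Where [z1 = 0] the angle has to be read off [z2] instead. *)
intros H.
destruct (Req_dec (Cmod z1) 0) as [Hz | Hz].
- destruct (Cmod_eq_polar (- z2)) as [theta Ht].
  exists theta; split.
  + rewrite Hz, Cmult_0_l; now apply Cmod_eq_0.
  + rewrite Cmod_opp in Ht.
    transitivity (- - z2)%C; [ring | rewrite Ht, RtoC_opp; ring].
- destruct (Cmod_eq_polar z1) as [theta Ht].
  exists theta; split; [easy | ].
  assert (Hd := Cmod_sqr (z1 - z2)); rewrite H in Hd.
  assert (H2 := Cmod_sqr z2).
  assert (Hsc := sin2_cos2 theta); unfold Rsqr in Hsc.
  assert (Hr := Cmod_ge_0 z1).
  set (r := Cmod z1) in *; set (s := Cmod z2) in *.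
  rewrite Ht in Hd.
  destruct z2 as [x y].
  unfold Cexpi, Cminus, Cplus, Copp, Cmult, RtoC in *; simpl in *.
  (* Expanding the squared distance shows that the inner product of [z2] with the direction of [z1]
     is [- s]; hence [z2 + s e^(i theta)] has squared modulus zero. *)
  assert (Hin : r * (x * cos theta + y * sin theta + s) = 0) by nra.
  apply Rmult_integral in Hin; destruct Hin as [Hin | Hin]; [easy | ].
  assert (Hsq : (x + s * cos theta)² + (y + s * sin theta)² = 0)
    by (unfold Rsqr; nra).
  apply Rplus_sqr_eq_0 in Hsq.
  f_equal; lra.
Qed.

Lemma Cmod_real_polar (x theta : R) :
  Cmod (RtoC x * Cexpi theta)%C = Rabs x.
Proof. now rewrite Cmod_mult, Cmod_R, Cmod_Cexpi, Rmult_1_r. Qed.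

(** * Comparison of the energy with its radial form *)

Lemma Wmicro_eq_radial (b : R) (p q : nat) (r s theta : R) :
  (0 < p)%nat -> (0 < q)%nat -> 0 <= r < 1 -> 0 <= s < 1 ->
  Wmicro b p q ((RtoC r * Cexpi theta)%C, (RtoC (- s) * Cexpi theta)%C)
  = - (2 * b ^ 2 * PI * INR p * INR q) * radial (calA p q) (calB b) r s.
Proof.
intros Hp Hq Hr Hs.
apply lt_0_INR in Hp; apply lt_0_INR in Hq.
unfold Wmicro, radial, calA; simpl fst; simpl snd.
rewrite !Cmod_real_polar, Rabs_Ropp, !Rabs_pos_eq by lra.
replace (RtoC r * Cexpi theta - RtoC (- s) * Cexpi theta)%C
  with (RtoC (r + s) * Cexpi theta)%C
  by (rewrite RtoC_plus, RtoC_opp; ring).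
replace (RtoC 1 - RtoC r * Cexpi theta * Cconj (RtoC (- s) * Cexpi theta))%C
  with (RtoC (1 + r * s)).
2: { assert (Hsc := sin2_cos2 theta); unfold Rsqr in Hsc.
     unfold Cexpi, Cconj, Cminus, Cplus, Copp, Cmult, RtoC; simpl.
     f_equal; [ | ring].
     transitivity (1 + r * s * (sin theta * sin theta + cos theta * cos theta));
       [rewrite Hsc | ]; ring. }
rewrite Cmod_real_polar, Cmod_R, !Rabs_pos_eq by nra.
field; lra.
Qed.

Lemma Wmicro_scale_pos (b : R) (p q : nat) :
  0 < b -> (0 < p)%nat -> (0 < q)%nat -> 0 < 2 * b ^ 2 * PI * INR p * INR q.
Proof.
intros Hb Hp Hq.
apply lt_0_INR in Hp; apply lt_0_INR in Hq.
assert (Hpi := PI_RGT_0).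
assert (Hb2 := pow_lt b 2 Hb).
assert (0 < b ^ 2 * PI) by now apply Rmult_lt_0_compat.
assert (0 < b ^ 2 * PI * INR p) by now apply Rmult_lt_0_compat.
assert (0 < b ^ 2 * PI * INR p * INR q) by now apply Rmult_lt_0_compat.
lra.
Qed.

(** Two triangle inequalities: [|z1 - z2| <= |z1| + |z2|] and [|1 - z1 conj z2| <= 1 + |z1| |z2|].
    Equality of energies forces equality in the first, which characterizes antipodal position. *)
Lemma Wmicro_ge_radial (b : R) (p q : nat) (z : C * C) :
  0 < b < 1 -> (0 < p)%nat -> (0 < q)%nat -> disc2_star z ->
  - (2 * b ^ 2 * PI * INR p * INR q)
    * radial (calA p q) (calB b) (Cmod (fst z)) (Cmod (snd z)) <= Wmicro b p q z
  /\ (Wmicro b p q z = - (2 * b ^ 2 * PI * INR p * INR q)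
        * radial (calA p q) (calB b) (Cmod (fst z)) (Cmod (snd z)) ->
      Cmod (fst z - snd z)%C = Cmod (fst z) + Cmod (snd z)).
Proof.
intros Hb Hp Hq [H1 [H2 Hne]].
destruct z as [z1 z2]; simpl fst in *; simpl snd in *.
assert (HK := Wmicro_scale_pos b p q (proj1 Hb) Hp Hq).
apply lt_0_INR in Hp; apply lt_0_INR in Hq.
assert (HB : 0 < calB b) by (unfold calB; apply Rdiv_lt_0_compat; nra).
assert (Hr := Cmod_ge_0 z1); assert (Hs := Cmod_ge_0 z2).
assert (Hd0 : 0 < Cmod (z1 - z2)%C).
{ apply Cmod_gt_0, Cminus_eq_contra, Hne. }
assert (Hd : Cmod (z1 - z2)%C <= Cmod z1 + Cmod z2).
{ unfold Cminus; rewrite <- (Cmod_opp z2); apply Cmod_triangle. }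
assert (Hm : Cmod (z1 * Cconj z2)%C = Cmod z1 * Cmod z2).
{ now rewrite Cmod_mult, Cmod_conj. }
assert (Hc : Cmod (RtoC 1 - z1 * Cconj z2)%C <= 1 + Cmod z1 * Cmod z2).
{ assert (H := Cmod_triangle (RtoC 1) (- (z1 * Cconj z2))).
  rewrite Cmod_1, Cmod_opp, Hm in H; exact H. }
assert (Hc0 : 0 < Cmod (RtoC 1 - z1 * Cconj z2)%C).
{ apply Cmod_gt_0, Cminus_eq_contra; intros E.
  rewrite <- E, Cmod_1 in Hm; nra. }
assert (Hlc := ln_le _ _ Hc0 Hc).
assert (Hld := ln_le _ _ Hd0 Hd).
unfold Wmicro; simpl fst; simpl snd.
(* The energy excess is exactly [K (u + B v)], where [u] and [v] are the nonnegative logarithmic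
   gaps in the two triangle inequalities. *)
assert (E : - b ^ 2 * PI *
    (2 * INR p * INR q * ln (Cmod (z1 - z2)%C)
     + calB b *
       (INR p ^ 2 * ln (1 - Cmod z1 ^ 2)
        + INR q ^ 2 * ln (1 - Cmod z2 ^ 2)
        + 2 * INR p * INR q * ln (Cmod (RtoC 1 - z1 * Cconj z2)%C)))
  = - (2 * b ^ 2 * PI * INR p * INR q)
      * radial (calA p q) (calB b) (Cmod z1) (Cmod z2)
    + 2 * b ^ 2 * PI * INR p * INR q
      * ((ln (Cmod z1 + Cmod z2) - ln (Cmod (z1 - z2)%C))
         + calB b * (ln (1 + Cmod z1 * Cmod z2)
                     - ln (Cmod (RtoC 1 - z1 * Cconj z2)%C)))).
{ unfold radial, calA; field; lra. }
rewrite E; clear E.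
set (K := 2 * b ^ 2 * PI * INR p * INR q) in *.
remember (ln (Cmod z1 + Cmod z2) - ln (Cmod (z1 - z2)%C)) as u eqn:Eu.
remember (ln (1 + Cmod z1 * Cmod z2) - ln (Cmod (RtoC 1 - z1 * Cconj z2)%C))
  as v eqn:Ev.
assert (HBv : 0 <= calB b * v) by (apply Rmult_le_pos; lra).
clearbody K.
split; [assert (0 <= K * (u + calB b * v)) by (apply Rmult_le_pos; lra); lra | ].
intros E.
assert (Hz : K * (u + calB b * v) = 0) by lra.
apply Rmult_integral in Hz; destruct Hz as [Hz | Hz]; [lra | ].
apply ln_inv; lra.
Qed.

(** * Bounds on the parameters and the quadratic equation *)

Lemma calB_bounds (b : R) : 0 < b < 1 -> 0 < calB b < 1.
Proof.
intros Hb; unfold calB; split.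
- apply Rdiv_lt_0_compat; nra.
- apply Rlt_div_l; nra.
Qed.

Lemma calA_bounds (p q : nat) :
  (0 < p)%nat -> (0 < q)%nat -> (p <= q)%nat -> 0 < calA p q <= 1.
Proof.
intros Hp Hq Hpq.
apply lt_0_INR in Hp; apply lt_0_INR in Hq; apply le_INR in Hpq.
unfold calA; split.
- now apply Rdiv_lt_0_compat.
- apply Rle_div_l; lra.
Qed.

(** From [A <= 1 <= / A]. The upper bound keeps the second vortex, of modulus [lambda * s0], inside
    the disc. *)
Lemma lambda_bounds (b : R) (p q : nat) :
  0 < calB b < 1 -> 0 < calA p q <= 1 -> 0 < lambda b p q <= 1.
Proof.
intros HB HA.
assert (HA' : 1 <= / calA p q).
{ rewrite <- Rinv_1; apply Rinv_le_contravar; lra. }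
unfold lambda; split.
- apply Rdiv_lt_0_compat; nra.
- apply Rle_div_l; nra.
Qed.

Lemma quad_lead_pos (b : R) (p q : nat) :
  0 < calB b < 1 -> 0 < calA p q <= 1 -> 0 < quad_lead b p q.
Proof.
intros HB HA; assert (Hl := lambda_bounds b p q HB HA); unfold quad_lead.
assert (0 < (calA p q + 1) * calB b) by nra.
assert (0 < (calA p q + 1) * calB b * lambda b p q) by nra.
nra.
Qed.

Lemma s0_root (b : R) (p q : nat) :
  0 < calB b < 1 -> 0 < calA p q <= 1 ->
  0 < s0 b p q /\
  quad_lead b p q * (s0 b p q ^ 2) ^ 2 + quad_lin b p q * s0 b p q ^ 2 - 1 = 0.
Proof.
intros HB HA.
assert (Hq := quad_lead_pos b p q HB HA).
unfold s0.
set (a := quad_lead b p q) in *; set (l := quad_lin b p q).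
assert (HD : 0 <= Defs.Delta b p q) by (unfold Defs.Delta; fold a l; nra).
assert (Hs : sqrt (Defs.Delta b p q) ^ 2 = l ^ 2 + 4 * a).
{ rewrite pow2_sqrt by easy; reflexivity. }
assert (Hs0 := sqrt_pos (Defs.Delta b p q)).
set (d := sqrt (Defs.Delta b p q)) in *.
(* [d ^ 2 = l ^ 2 + 4 a > l ^ 2] and [d >= 0]. *)
assert (Hn : 0 < - l + d) by nra.
assert (Hx : 0 < (- l + d) / (2 * a)) by (apply Rdiv_lt_0_compat; lra).
split; [now apply sqrt_lt_R0 | ].
rewrite pow2_sqrt by lra.
replace (a * ((- l + d) / (2 * a)) ^ 2 + l * ((- l + d) / (2 * a)) - 1)
  with ((d ^ 2 - l ^ 2 - 4 * a) / (4 * a)) by (field; lra).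
rewrite Hs; field; lra.
Qed.

Lemma s0_lt_1 (b : R) (p q : nat) :
  0 < calB b < 1 -> 0 < calA p q <= 1 -> s0 b p q < 1.
Proof.
intros HB HA.
destruct (s0_root b p q HB HA) as [Hpos Hroot].
assert (Hq := quad_lead_pos b p q HB HA).
assert (Hl := lambda_bounds b p q HB HA).
(* The quadratic polynomial is positive at [1]. *)
assert (H1 : 0 < quad_lead b p q + quad_lin b p q - 1).
{ replace (quad_lead b p q + quad_lin b p q - 1)
    with (calB b * calA p q * (1 + lambda b p q) ^ 2)
    by (unfold quad_lead, quad_lin; ring).
  apply Rmult_lt_0_compat; nra. }
set (a := quad_lead b p q) in *; set (l := quad_lin b p q) in *.
set (X := s0 b p q ^ 2) in *.
destruct (Rlt_le_dec (s0 b p q) 1) as [H | H]; [easy | exfalso].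
assert (HX : 1 <= X) by (unfold X; nra).
(* For [X >= 1], [a X^2 + l X - 1 >= (a + l) X - 1 > 0], so [X] is not a root. *)
assert (HaX : 0 <= a * X * (X - 1)).
{ apply Rmult_le_pos; nra. }
assert (0 < (a + l) * X - 1) by nra.
nra.
Qed.

Lemma s0_critical (b : R) (p q : nat) :
  0 < calB b < 1 -> 0 < calA p q <= 1 ->
  let T := tanh_add (s0 b p q) (lambda b p q * s0 b p q) in
  (1 + calB b * (calA p q + 1)) * s0 b p q = / T + calB b * T
  /\ (1 + calB b * (/ calA p q + 1)) * (lambda b p q * s0 b p q) = / T + calB b * T.
Proof.
intros HB HA T.
destruct (s0_root b p q HB HA) as [Hpos Hroot].
assert (Hl := lambda_bounds b p q HB HA).
assert (HA' : 0 < / calA p q) by (apply Rinv_0_lt_compat; lra).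
assert (Hr : (1 + calB b * (calA p q + 1)) * s0 b p q = / T + calB b * T).
{ unfold T, tanh_add.
  unfold quad_lead, quad_lin in Hroot.
  set (r := s0 b p q) in *; set (A := calA p q) in *; set (B := calB b) in *;
    set (L := lambda b p q) in *.
  assert (H1 : 0 < 1 + r * (L * r)) by (assert (0 < L * r) by nra; nra).
  assert (H2 : 0 < r + L * r) by nra.
  (* With denominators cleared, the difference of the two sides is exactly the quadratic in
     [r ^ 2]. *)
  assert (E : (1 + B * (A + 1)) * r * (r + L * r) * (1 + r * (L * r))
    = (1 + r * (L * r)) ^ 2 + B * (r + L * r) ^ 2).
  { apply Rminus_diag_uniq; rewrite <- Hroot; ring. }
  apply (Rmult_eq_reg_r ((r + L * r) * (1 + r * (L * r)))); [ | nra].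
  rewrite <- Rmult_assoc, E; field; lra. }
split; [easy | ].
(* [lambda] is the ratio of the two coefficients, so both left-hand sides agree. *)
rewrite <- Hr; unfold lambda; field.
split; [ | nra]; nra.
Qed.

(** * The set of minimizers *)

(** The energy is bounded below by its radial form, then by the radial optimum. A minimizer attains
    equality in both: the second fixes the moduli, the first makes the points antipodal. *)
Lemma Wmicro_minimizers (b : R) (p q : nat) (z : C * C) :
  0 < b < 1 -> (0 < p)%nat -> (0 < q)%nat -> (p <= q)%nat ->
  is_global_minimizer disc2_star (Wmicro b p q) z <->
  exists theta : R,
    z = ((RtoC (s0 b p q) * Cexpi theta)%C,
         (RtoC (- lambda b p q * s0 b p q) * Cexpi theta)%C).
Proof.
intros Hb Hp Hq Hpq.
assert (HB := calB_bounds b Hb).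
assert (HA := calA_bounds p q Hp Hq Hpq).
assert (Hl := lambda_bounds b p q HB HA).
assert (Hr0 := proj1 (s0_root b p q HB HA)).
assert (Hr1 := s0_lt_1 b p q HB HA).
destruct (s0_critical b p q HB HA) as [Hc1 Hc2].
assert (HK : 0 < 2 * b ^ 2 * PI * INR p * INR q).
{ now apply Wmicro_scale_pos. }
rewrite <- Ropp_mult_distr_l.
set (r0 := s0 b p q) in *.
set (s1 := lambda b p q * r0) in *.
assert (Hs1 : 0 < s1 < 1) by (unfold s1; nra).
set (m := fun theta => ((RtoC r0 * Cexpi theta)%C, (RtoC (- s1) * Cexpi theta)%C)).
assert (HmD : forall theta, disc2_star (m theta)).
{ intros theta; unfold m, disc2_star; simpl fst; simpl snd.
  rewrite !Cmod_real_polar, Rabs_Ropp, !Rabs_pos_eq by lra.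
  repeat split; try lra; intros E.
  apply (f_equal (fun w => (w - RtoC (- s1) * Cexpi theta)%C)) in E.
  replace (RtoC r0 * Cexpi theta - RtoC (- s1) * Cexpi theta)%C
    with (RtoC (r0 + s1) * Cexpi theta)%C in E
    by (rewrite RtoC_plus, RtoC_opp; ring).
  apply (f_equal Cmod) in E.
  rewrite Cmod_real_polar, Rabs_pos_eq in E by lra.
  unfold Cminus in E; rewrite Cplus_opp_r, Cmod_0 in E; lra. }
assert (HmW : forall theta, Wmicro b p q (m theta)
  = - (2 * b ^ 2 * PI * INR p * INR q) * radial (calA p q) (calB b) r0 s1).
{ intros theta; apply Wmicro_eq_radial; try easy; lra. }
assert (Hrad : forall w, disc2_star w ->
  (Cmod (fst w), Cmod (snd w)) <> (r0, s1) ->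
  radial (calA p q) (calB b) (Cmod (fst w)) (Cmod (snd w))
  < radial (calA p q) (calB b) r0 s1).
{ intros w [Hw1 [Hw2 Hw]] Hne.
  assert (H1 := Cmod_ge_0 (fst w)); assert (H2 := Cmod_ge_0 (snd w)).
  apply radial_strict_max; try easy; try lra.
  (* Both moduli zero would make the two points coincide. *)
  destruct (Req_dec (Cmod (fst w) + Cmod (snd w)) 0) as [E | E]; [ | lra].
  exfalso; apply Hw.
  rewrite (Cmod_eq_0 (fst w)), (Cmod_eq_0 (snd w)) by lra; easy. }
assert (Heq : forall w : C * C, {(Cmod (fst w), Cmod (snd w)) = (r0, s1)}
  + {(Cmod (fst w), Cmod (snd w)) <> (r0, s1)}).
{ intros w.
  destruct (Req_EM_T (Cmod (fst w)) r0) as [E1 | E1]; [ | right; congruence].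
  destruct (Req_EM_T (Cmod (snd w)) s1) as [E2 | E2]; [ | right; congruence].
  left; congruence. }
split.
- intros [HD Hmin].
  (* The angle [0] is an arbitrary choice: all [m theta] have the same energy. *)
  specialize (Hmin (m 0) (HmD 0)); rewrite HmW in Hmin.
  destruct (Wmicro_ge_radial b p q z Hb Hp Hq HD) as [Hge Hanti].
  destruct (Heq z) as [E | E].
  + injection E; intros E2 E1.
    rewrite E1, E2 in Hge, Hanti.
    specialize (Hanti ltac:(lra)).
    rewrite <- E1, <- E2 in Hanti.
    destruct (antipodal_of_Cmod_minus _ _ Hanti) as [theta [H1 H2]].
    exists theta.
    rewrite E1 in H1; rewrite E2 in H2.
    rewrite (surjective_pairing z); f_equal; assumption.
  + specialize (Hrad z HD E); nra.
- intros [theta ->]; fold (m theta); split; [apply HmD | ].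
  intros w HD; rewrite HmW.
  destruct (Wmicro_ge_radial b p q w Hb Hp Hq HD) as [Hge _].
  destruct (Heq w) as [E | E].
  + injection E; intros E2 E1; rewrite E1, E2 in Hge; easy.
  + specialize (Hrad w HD E); nra.
Qed.

(** * Equal degrees *)

Lemma calA_diag (p : nat) : (0 < p)%nat -> calA p p = 1.
Proof. intros Hp; apply lt_0_INR in Hp; unfold calA; field; lra. Qed.

Lemma lambda_diag (b : R) (p : nat) :
  0 < b < 1 -> (0 < p)%nat -> lambda b p p = 1.
Proof.
intros Hb Hp; assert (HB := calB_bounds b Hb).
unfold lambda; rewrite calA_diag, Rinv_1 by easy; field; lra.
Qed.

(** With [A = lambda = 1] the linear coefficient vanishes and the quadratic equation becomes
    [(1 + 4 B) s^4 = 1]. *)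
Lemma s0_diag (b : R) (p : nat) :
  0 < b < 1 -> (0 < p)%nat ->
  s0 b p p = Rpower (1 + 4 * calB b) (- (1 / 4)).
Proof.
intros Hb Hp; assert (HB := calB_bounds b Hb).
assert (HA : 0 < calA p p <= 1) by (rewrite calA_diag by easy; lra).
destruct (s0_root b p p HB HA) as [Hpos Hroot].
unfold quad_lead, quad_lin in Hroot.
rewrite lambda_diag, calA_diag in Hroot by easy.
set (s := s0 b p p) in *.
assert (E : 1 + 4 * calB b = Rpower s (- 4)).
{ replace (-4) with (- INR 4) by (simpl; ring).
  rewrite Rpower_Ropp, Rpower_pow by easy.
  apply (Rmult_eq_reg_r (s ^ 4)); [ | apply pow_nonzero; lra].
  rewrite Rinv_l by (apply pow_nonzero; lra); lra. }
rewrite E, Rpower_mult.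
replace (- 4 * - (1 / 4)) with 1 by field.
now rewrite Rpower_1.
Qed.

Theorem mainTheorem3 (b : R) (p q : nat)
    (hb0 : 0 < b) (hb1 : b < 1)
    (hp : (0 < p)%nat) (hq : (0 < q)%nat) (hpq : (p <= q)%nat) :
  (forall z : C * C,
     is_global_minimizer disc2_star (Wmicro b p q) z <->
     exists theta : R,
       z = ((RtoC (s0 b p q) * Cexpi theta)%C,
            (RtoC (- lambda b p q * s0 b p q) * Cexpi theta)%C))
  /\
  (p = q ->
   forall z : C * C,
     is_global_minimizer disc2_star (Wmicro b p p) z <->
     exists theta : R,
       z = ((RtoC (Rpower (1 + 4 * ((1 - b ^ 2) / (1 + b ^ 2))) (- (1 / 4))) * Cexpi theta)%C,
            (- (RtoC (Rpower (1 + 4 * ((1 - b ^ 2) / (1 + b ^ 2))) (- (1 / 4))) * Cexpi theta))%C)).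
Proof.
split; [intros z; now apply Wmicro_minimizers | ].
intros _ z.
rewrite Wmicro_minimizers by easy.
rewrite lambda_diag, s0_diag by easy.
unfold calB.
set (s := Rpower _ _).
assert (E : forall theta,
  (RtoC (- (1) * s) * Cexpi theta)%C = (- (RtoC s * Cexpi theta))%C).
{ intros theta; rewrite RtoC_mult, RtoC_opp; ring. }
split; intros [theta ->]; exists theta; now rewrite E.
Qed.
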